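(* If $Q$ and $Q'$ are isomorphic finite quandles, then $qp_Q(s,t)=qp_{Q'}(s,t)$.
   Context: A quandle is a set $Q$ with a binary operation $\triangleright:Q\times Q\to Q$ satisfying: (i) for every $a\in Q$, $a\triangleright a=a$; (ii) for every $a,b\in Q$ there is a unique $c\in Q$ such that $a=c\triangleright b$; (iii) for every $a,b,c\in Q$, $(a\triangleright b)\triangleright c=(a\triangleright c)\triangleright(b\triangleright c)$. A homomorphism of quandles is a map $f:Q\to Q'$ with $f(x\triangleright y)=f(x)\triangleright f(y)$ for all $x,y\in Q$; an isomorphism is a bijective homomorphism. For a finite quandle $Q$ and $x\in Q$, let $c(x)=|\{y\in Q : y\triangleright x=y\}|$ and $r(x)=|\{y\in Q : x\triangleright y=x\}|$. The quandle polynomial of $Q$ is $qp_Q(s,t)=\sum_{x\in Q}s^{r(x)}t^{c(x)}$, a polynomial in two variables $s,t$ with integer coefficients. *)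

(* Defs.v *)
From HB Require Import structures.
From mathcomp Require Import all_boot all_order all_algebra.
From mathcomp Require Import mpoly.

Set Implicit Arguments.
Unset Strict Implicit.
Unset Printing Implicit Defensive.

Import GRing.Theory.
Local Open Scope ring_scope.

Reserved Notation "x |> y" (at level 50, left associativity).

HB.mixin Record isQuandle Q := {
  qop : Q -> Q -> Q;
  qop_idem : forall a, qop a a = a;
  qop_rdiv : forall a b, exists! c, a = qop c b;
  qop_distr : forall a b c, qop (qop a b) c = qop (qop a c) (qop b c)
}.

#[short(type="quandleType")]
HB.structure Definition Quandle := {Q of isQuandle Q}.

#[short(type="finQuandleType")]
HB.structure Definition FinQuandle := {Q of Finite Q & isQuandle Q}.

Declare Scope quandle_scope.
Delimit Scope quandle_scope with Qdl.
Notation "x |> y" := (qop x y) : quandle_scope.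
Local Open Scope quandle_scope.

Definition quandle_morphism (Q Q' : quandleType) (f : Q -> Q') : Prop :=
  forall x y : Q, f (x |> y) = f x |> f y.

Definition quandle_isomorphism (Q Q' : quandleType) (f : Q -> Q') : Prop :=
  quandle_morphism f /\ bijective f.

Definition quandle_isomorphic (Q Q' : quandleType) : Prop :=
  exists f : Q -> Q', quandle_isomorphism f.

Definition quandle_c (Q : finQuandleType) (x : Q) : nat :=
  #|[set y : Q | y |> x == y]|.

Definition quandle_r (Q : finQuandleType) (x : Q) : nat :=
  #|[set y : Q | x |> y == x]|.

(* The two variables of {mpoly int[2]}: s is the first, t the second. *)
Definition quandle_poly (Q : finQuandleType) : {mpoly int[2]} :=
  let s := 'X_ord0 in
  let t := 'X_ord_max in
  \sum_(x : Q) s ^+ quandle_r x * t ^+ quandle_c x.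

(* Main.v *)
Require Import Defs.
From mathcomp Require Import all_boot all_order all_algebra.
From mathcomp Require Import mpoly.

(** An isomorphism [f] carries the equation [y |> x = y] to
    [f y |> f x = f y], and reflects it because [f] is injective; likewise for
    [x |> y = x]. So the sets counted by [quandle_c x] and [quandle_r x] are
    the preimages under [f] of those counted at [f x], and a bijection preserves
    the cardinals of preimages. The monomial attached to [x] is thus the one
    attached to [f x], and reindexing the sum over [Q'] along [f] identifies
    the two polynomials. *)

Lemma quandle_c_iso (Q Q' : finQuandleType) (f : Q -> Q') (x : Q) :
  quandle_isomorphism f -> quandle_c (f x) = quandle_c x.
Proof.
move=> [fM f_bij]; rewrite /quandle_c.
rewrite -(on_card_preimset (onW_bij _ f_bij)).
by apply: eq_card => y; rewrite !inE -fM (bij_eq f_bij).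
Qed.

Lemma quandle_r_iso (Q Q' : finQuandleType) (f : Q -> Q') (x : Q) :
  quandle_isomorphism f -> quandle_r (f x) = quandle_r x.
Proof.
move=> [fM f_bij]; rewrite /quandle_r.
rewrite -(on_card_preimset (onW_bij _ f_bij)).
by apply: eq_card => y; rewrite !inE -fM (bij_eq f_bij).
Qed.

Theorem proposition1 (Q Q' : finQuandleType) :
  quandle_isomorphic Q Q' -> quandle_poly Q = quandle_poly Q'.
Proof.
move=> [f f_iso]; have [_ f_bij] := f_iso.
rewrite /quandle_poly [RHS](reindex f) /=; last exact: onW_bij.
by apply: eq_bigr => x _; rewrite quandle_c_iso // quandle_r_iso.
Qed.
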